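(* Let $d\ge 1$ and let $\{\Lambda_t\}_{t\ge 0}$ be a family of completely positive trace preserving linear maps $\Lambda_t:B(\mathbb{C}^d)\to B(\mathbb{C}^d)$ with $\Lambda_0=\mathcal{I}_d$ (not necessarily bijective). If there exist two states $\rho_1,\rho_2$ on $\mathbb{C}^{d+1}\otimes\mathbb{C}^d$ and two times $0\le s<t$ such that $$\|(\mathcal{I}_{d+1}\otimes\Lambda_s)(\rho_1-\rho_2)\|_1<\|(\mathcal{I}_{d+1}\otimes\Lambda_t)(\rho_1-\rho_2)\|_1,$$ then there exist two separable states $\rho_1',\rho_2'$ on $\mathbb{C}^{d+1}\otimes\mathbb{C}^d$ such that, for the same times $s<t$, $$\|(\mathcal{I}_{d+1}\otimes\Lambda_s)(\rho_1'-\rho_2')\|_1<\|(\mathcal{I}_{d+1}\otimes\Lambda_t)(\rho_1'-\rho_2')\|_1.$$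
   Context: $B(\mathbb{C}^n)$ is the space of linear operators on $\mathbb{C}^n$; a state is a positive semidefinite operator of trace one; $\mathcal{I}_n$ is the identity map on $B(\mathbb{C}^n)$; $\|\cdot\|_1$ is the trace norm. A state on $\mathbb{C}^{d+1}\otimes\mathbb{C}^d$ is separable if it is a finite convex combination of product states $\alpha\otimes\beta$, with $\alpha$ a state on $\mathbb{C}^{d+1}$ and $\beta$ a state on $\mathbb{C}^d$. *)

(* Defs.v *)
From mathcomp Require Import all_boot all_order all_algebra.
From mathcomp Require Import mxtens.

Set Implicit Arguments.
Unset Strict Implicit.
Unset Printing Implicit Defensive.

Import Order.TTheory GRing.Theory Num.Theory Num.Def.
Local Open Scope ring_scope.
Local Open Scope sesquilinear_scope.

(* An operator on C^n is identified with its matrix in the standard basis, and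
   C^m (x) C^n with C^(m * n) through mxtens_index, so that the tensor product
   of operators is the Kronecker product tensmx. *)

Section Operators.

Variable C : numClosedFieldType.

Definition psdmx n (A : 'M[C]_n) : Prop :=
  A \is hermsymmx /\ forall v : 'cV[C]_n, 0 <= (v ^t* *m A *m v) 0 0.

Definition state n (rho : 'M[C]_n) : Prop := psdmx rho /\ \tr rho = 1.

(* In C, 0 <= p i says that p i is real and nonnegative. *)
Definition separable m n (rho : 'M[C]_(m * n)) : Prop :=
  state rho /\
  exists (N : nat) (p : 'I_N -> C) (a : 'I_N -> 'M[C]_m) (b : 'I_N -> 'M[C]_n),
    [/\ forall i, 0 <= p i,
        \sum_i p i = 1,
        forall i, state (a i),
        forall i, state (b i) &
        rho = \sum_i p i *: tensmx (a i) (b i)].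

(* The square root of a positive semidefinite A, by functional calculus on its
   spectral decomposition A = P^-1 diag(d) P (with P unitary). *)
Definition sqrtmx n (A : 'M[C]_n) : 'M[C]_n :=
  invmx (spectralmx A) *m diag_mx (map_mx sqrtC (spectral_diag A))
    *m spectralmx A.

(* ||A||_1 = tr sqrt(A^* A); like the norm `|z| of z : C, it is an element of C
   which is real and nonnegative (trnorm_ge0). *)
Definition trnorm n (A : 'M[C]_n) : C := \tr (sqrtmx (A ^t* *m A)).

(* F (x) G, given by its action on the basis E_ik (x) E_jl; it is characterized
   by tensmap_tens. *)
Definition tensmap m m' n n' (F : {linear 'M[C]_m -> 'M[C]_m'})
    (G : {linear 'M[C]_n -> 'M[C]_n'}) (X : 'M[C]_(m * n)) : 'M[C]_(m' * n') :=
  \sum_(i < m) \sum_(k < m) \sum_(j < n) \sum_(l < n)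
    X (mxtens_index (i, j)) (mxtens_index (k, l))
      *: tensmx (F (delta_mx i k)) (G (delta_mx j l)).

Definition id_tensmap k n n' (F : {linear 'M[C]_n -> 'M[C]_n'}) :
    'M[C]_(k * n) -> 'M[C]_(k * n') :=
  tensmap (idfun : {linear 'M[C]_k -> 'M[C]_k}) F.

Definition completely_positive n n' (F : {linear 'M[C]_n -> 'M[C]_n'}) : Prop :=
  forall (k : nat) (X : 'M[C]_(k * n)), psdmx X -> psdmx (id_tensmap F X).

Definition trace_preserving n n' (F : {linear 'M[C]_n -> 'M[C]_n'}) : Prop :=
  forall X, \tr (F X) = \tr X.

Lemma psdmx_gram m n (A : 'M[C]_(m, n)) : psdmx (A ^t* *m A).
Proof.
split.
  apply/is_hermitianmxP; rewrite expr0 scale1r trmx_mul map_mxM.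
  by rewrite -[in LHS](trmxCK A) trmxCK.
move=> v; rewrite mulmxA -[_ *m _ *m _ *m v]mulmxA -map_mxM -trmx_mul mxE.
by apply: sumr_ge0 => i _; rewrite !mxE mulrC -normCK exprn_ge0.
Qed.

Lemma psdmx_spectral n (A : 'M[C]_n) :
  psdmx A ->
  A = invmx (spectralmx A) *m diag_mx (spectral_diag A) *m spectralmx A
  /\ forall i, 0 <= spectral_diag A 0 i.
Proof.
case=> hA pA; have E := orthomx_spectralP (hermitian_normalmx hA).
split=> // i; move: E (spectral_unitarymx A) (spectral_unit A).
move: (spectralmx A) (spectral_diag A) => P D E U Pu.
have := pA (invmx P *m delta_mx i 0); rewrite E (invmx_unitary U).
rewrite trmx_mul map_mxM trmxCK -(invmx_unitary U) !mulmxA.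
rewrite mulmxK // mulmxK // -mulmxA mul_diag_mx mxE (bigD1 i) //= big1 => [|j ji].
  by rewrite !mxE !eqxx /= conjC1 mul1r mulr1 addr0.
by rewrite !mxE (negPf ji) /= conjC0 mul0r.
Qed.

Lemma sqrtmxK n (A : 'M[C]_n) :
  psdmx A -> sqrtmx A *m sqrtmx A = A.
Proof.
move=> /psdmx_spectral [E _]; rewrite [RHS]E /sqrtmx !mulmxA.
rewrite mulmxK ?spectral_unit //; congr (_ *m _).
rewrite -!mulmxA mulmx_diag; congr (_ *m diag_mx _).
by apply/rowP => i; rewrite !mxE -expr2 sqrtCK.
Qed.

Lemma trnorm_ge0 n (A : 'M[C]_n) : 0 <= trnorm A.
Proof.
rewrite /trnorm /sqrtmx mxtrace_mulC mulmxA mulmxV ?spectral_unit //.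
rewrite mul1mx mxtrace_diag; apply: sumr_ge0 => i _.
by rewrite mxE sqrtC_ge0; have [_ ->] := psdmx_spectral (psdmx_gram A).
Qed.

Lemma tensmap_tens m m' n n' (F : {linear 'M[C]_m -> 'M[C]_m'})
    (G : {linear 'M[C]_n -> 'M[C]_n'}) (A : 'M[C]_m) (B : 'M[C]_n) :
  tensmap F G (tensmx A B) = tensmx (F A) (G B).
Proof.
rewrite [in RHS](matrix_sum_delta A) [in RHS](matrix_sum_delta B) !linear_sum /=.
apply/matrixP=> x y; rewrite !mxE !summxE mulr_suml.
apply: eq_bigr => i _; rewrite !linear_sum !summxE mulr_suml.
apply: eq_bigr => k _; rewrite !summxE mulr_sumr.
apply: eq_bigr => j _; rewrite !linear_sum !summxE mulr_sumr.
apply: eq_bigr => l _; rewrite !linearZ !mxE !mxtens_indexK /=.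
by rewrite mulrACA.
Qed.

End Operators.

(* Main.v *)
(** The constraint that the states be separable costs nothing, because the
    maximally mixed state is interior to the set of separable states: for
    Hermitian [A] and [B] and [a, b] large, [a b I + A (x) B] is half of
    [(a I + A) (x) (b I + B) + (a I - A) (x) (b I - B)], and every Hermitian
    operator is a real combination of such products.  Hence [c I + rho1] and
    [c I + rho2] are unnormalized separable states for some common [c]; the
    difference of their normalizations is a positive multiple of
    [rho1 - rho2], and both sides of the inequality are homogeneous. *)
Require Import Defs.
From mathcomp Require Import all_boot all_order all_algebra.
From mathcomp Require Import reals complex mxtens ring.
Import Order.TTheory GRing.Theory Num.Theory.
Local Open Scope ring_scope.
Local Open Scope complex_scope.
Local Open Scope sesquilinear_scope.

(** * Functional calculus, positive operators and homogeneity of the trace norm *)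

(** With $W = P Q^{-1}$ the hypothesis reads $d_i w_{ij} = w_{ij} e_j$. So $d_i = e_j$ wherever
    $w_{ij} \ne 0$, and the same relation holds for $f(d_i)$ and $f(e_j)$. This makes [sqrtmx]
    independent of the diagonalization chosen. *)
Lemma diag_calculus_unique (F : fieldType) (n : nat) (f : F -> F)
    (P Q : 'M[F]_n) (d e : 'rV[F]_n) :
  P \in unitmx -> Q \in unitmx ->
  invmx P *m diag_mx d *m P = invmx Q *m diag_mx e *m Q ->
  invmx P *m diag_mx (map_mx f d) *m P = invmx Q *m diag_mx (map_mx f e) *m Q.
Proof.
move=> Pu Qu /(congr1 (fun X => P *m X *m invmx Q)).
rewrite !mulmxA mulmxV // mul1mx mulmxK // -mulmxA => E.
suff E' : diag_mx (map_mx f d) *m (P *m invmx Q)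
        = P *m invmx Q *m diag_mx (map_mx f e).
  have Qu' : invmx Q \in unitmx by rewrite unitmx_inv.
  apply: (can_inj (mulKmx Pu)); apply: (can_inj (mulmxK Qu')).
  by rewrite !mulmxA mulmxV // mul1mx mulmxK // -mulmxA.
apply/matrixP => i j; move/matrixP/(_ i j): E.
rewrite !mul_diag_mx !mul_mx_diag !mxE.
set w := \sum_k _; have [->|w0] := eqVneq w 0; first by rewrite !mulr0 !mul0r.
by rewrite mulrC => /(mulfI w0) ->; rewrite mulrC.
Qed.

Section Operators.

Set Implicit Arguments.
Unset Strict Implicit.

Variable C : numClosedFieldType.

Lemma hermsymmxE (n : nat) (A : 'M[C]_n) : (A \is hermsymmx) = (A == A ^t*).
Proof. by rewrite qualifE /= expr0 scale1r. Qed.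

Lemma adjmxD (m n : nat) (A B : 'M[C]_(m, n)) : (A + B) ^t* = A ^t* + B ^t*.
Proof. by rewrite linearD map_mxD. Qed.

Lemma adjmxZ (m n : nat) (c : C) (A : 'M[C]_(m, n)) :
  (c *: A) ^t* = c^* *: A ^t*.
Proof. by rewrite linearZ /= map_mxZ. Qed.

Lemma psdmxD (n : nat) (A B : 'M[C]_n) : psdmx A -> psdmx B -> psdmx (A + B).
Proof.
move=> [hA pA] [hB pB]; split=> [|v].
  by move: hA hB; rewrite !hermsymmxE adjmxD => /eqP <- /eqP <-.
by rewrite mulmxDr mulmxDl mxE addr_ge0.
Qed.

Lemma psdmxZ (n : nat) (c : C) (A : 'M[C]_n) :
  0 <= c -> psdmx A -> psdmx (c *: A).
Proof.
move=> c0 [hA pA]; split=> [|v].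
  by move: hA; rewrite !hermsymmxE adjmxZ (CrealP (ger0_real c0)) => /eqP <-.
by rewrite -scalemxAr -scalemxAl mxE mulr_ge0.
Qed.

Lemma psdmx_scalar (n : nat) (c : C) : 0 <= c -> psdmx (c%:M : 'M[C]_n).
Proof.
move=> c0; rewrite -scalemx1; apply: psdmxZ => //.
by have := psdmx_gram (1%:M : 'M[C]_n); rewrite mulmx1 trmx1 map_mx1.
Qed.

(** Since $P^{-1} = P^\dagger$, the operator is the Gram matrix of $\sqrt{D} P$, where $D$ is the
    diagonal matrix of [d]. *)
Lemma psdmx_unitary_diag (n : nat) (P : 'M[C]_n) (d : 'rV[C]_n) :
  P \is unitarymx -> (forall i, 0 <= d 0 i) ->
  psdmx (invmx P *m diag_mx d *m P).
Proof.
move=> Pu d0; pose S := diag_mx (map_mx sqrtC d) *m P.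
suff -> : invmx P *m diag_mx d *m P = S ^t* *m S by exact: psdmx_gram.
rewrite trmx_mul map_mxM tr_diag_mx map_diag_mx invmx_unitary // !mulmxA.
rewrite -[_ *m diag_mx _ *m diag_mx _]mulmxA mulmx_diag.
congr (_ *m diag_mx _ *m _); apply/rowP => i; rewrite !mxE /=.
have /CrealP -> : sqrtC (d 0 i) \is Num.real by rewrite ger0_real ?sqrtC_ge0.
by rewrite -expr2 sqrtCK.
Qed.

(** The eigenbases chosen for [A] and [c ^+ 2 *: A] may differ. The rescaled decomposition of [A] is
    a second diagonalization of [c ^+ 2 *: A], and the two give the same square root. *)
Lemma sqrtmxZ (n : nat) (c : C) (A : 'M[C]_n) :
  0 <= c -> psdmx A -> sqrtmx (c ^+ 2 *: A) = c *: sqrtmx A.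
Proof.
move=> c0 pA; have [EA dA] := psdmx_spectral pA.
have [EcA _] := psdmx_spectral (psdmxZ (exprn_ge0 2 c0) pA).
have E : invmx (spectralmx A) *m diag_mx (c ^+ 2 *: spectral_diag A)
          *m spectralmx A = c ^+ 2 *: A.
  by rewrite linearZ /= -scalemxAr -scalemxAl -EA.
rewrite [in RHS]/sqrtmx scalemxAl scalemxAr -linearZ /=.
have -> : c *: map_mx sqrtC (spectral_diag A)
        = map_mx sqrtC (c ^+ 2 *: spectral_diag A).
  apply/rowP => i; rewrite !mxE sqrtCM ?nnegrE ?exprn_ge0 //.
  by rewrite sqrCK.
apply: diag_calculus_unique; rewrite ?spectral_unit //.
by rewrite E [RHS]EcA.
Qed.

Lemma trnormZ (n : nat) (c : C) (A : 'M[C]_n) :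
  0 <= c -> trnorm (c *: A) = c * trnorm A.
Proof.
move=> c0; rewrite /trnorm adjmxZ (CrealP (ger0_real c0)).
rewrite -scalemxAl -scalemxAr scalerA -expr2 sqrtmxZ ?mxtraceZ //.
exact: psdmx_gram.
Qed.

Lemma id_tensmapZ (k n n' : nat) (F : {linear 'M[C]_n -> 'M[C]_n'}) (c : C)
    (X : 'M[C]_(k * n)) :
  id_tensmap F (c *: X) = c *: id_tensmap F X.
Proof.
rewrite /id_tensmap /tensmap; do 4!(rewrite scaler_sumr; apply: eq_bigr => ? _).
by rewrite mxE scalerA.
Qed.

Lemma trnorm_id_tensmapZ (k n n' : nat) (F : {linear 'M[C]_n -> 'M[C]_n'})
    (c : C) (X : 'M[C]_(k * n)) :
  0 <= c -> trnorm (id_tensmap F (c *: X)) = c * trnorm (id_tensmap F X).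
Proof. by move=> c0; rewrite id_tensmapZ trnormZ. Qed.

(** * Kronecker products *)

Lemma tensmxZl (m n p q : nat) (c : C) (A : 'M[C]_(m, n)) (B : 'M[C]_(p, q)) :
  tensmx (c *: A) B = c *: tensmx A B.
Proof. by apply/matrixP => i j; rewrite !mxE mulrA. Qed.

Lemma tensmxZr (m n p q : nat) (c : C) (A : 'M[C]_(m, n)) (B : 'M[C]_(p, q)) :
  tensmx A (c *: B) = c *: tensmx A B.
Proof. by apply/matrixP => i j; rewrite !mxE mulrCA. Qed.

Lemma mxtens_index_eq (m n : nat) (i k : 'I_m) (j l : 'I_n) :
  (mxtens_index (i, j) == mxtens_index (k, l)) = (i == k) && (j == l).
Proof. by rewrite -xpair_eqE; apply: can_eq; exact: mxtens_indexK. Qed.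

Lemma scalar_mx_tens (m n : nat) (a b : C) :
  (a * b)%:M = tensmx (a%:M : 'M[C]_m) (b%:M : 'M[C]_n).
Proof.
apply/matrixP => x y.
case: (mxtens_indexP x) => i j; case: (mxtens_indexP y) => k l.
rewrite !mxE !mxtens_indexK /= mxtens_index_eq.
by rewrite mulrnAl mulrnAr -mulrnA mulnb andbC.
Qed.

Lemma mxtrace_tens (m n : nat) (A : 'M[C]_m) (B : 'M[C]_n) :
  \tr (tensmx A B) = \tr A * \tr B.
Proof. by rewrite /mxtrace mulr_sum; apply: eq_bigr => i _; rewrite mxE. Qed.

(** * Normalization and the cone of unnormalized separable states *)

Lemma state_normalize (n : nat) (A : 'M[C]_n) :
  psdmx A -> 0 < \tr A -> state ((\tr A)^-1 *: A).
Proof.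
move=> pA tA; split; first by apply: psdmxZ => //; rewrite invr_ge0 ltW.
by rewrite mxtraceZ mulVf ?gt_eqF.
Qed.

(* The condition on the traces excludes zero factors, which cannot be normalized
   to states. *)
Definition sepcone (m n : nat) (X : 'M[C]_(m * n)) : Prop :=
  exists (N : nat) (a : 'I_N -> 'M[C]_m) (b : 'I_N -> 'M[C]_n),
    [/\ forall i, psdmx (a i) /\ 0 < \tr (a i),
        forall i, psdmx (b i) /\ 0 < \tr (b i) &
        X = \sum_i tensmx (a i) (b i)].

Lemma sepcone0 (m n : nat) : sepcone (0 : 'M[C]_(m * n)).
Proof.
by exists 0%N, (fun=> 0), (fun=> 0); split=> [[]|[]|] //; rewrite big_ord0.
Qed.

Lemma sepcone_tens (m n : nat) (A : 'M[C]_m) (B : 'M[C]_n) :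
  psdmx A -> 0 < \tr A -> psdmx B -> 0 < \tr B -> sepcone (tensmx A B).
Proof.
move=> pA tA pB tB; exists 1%N, (fun=> A), (fun=> B).
by split=> //; rewrite big_ord1.
Qed.

Lemma sepconeD (m n : nat) (X Y : 'M[C]_(m * n)) :
  sepcone X -> sepcone Y -> sepcone (X + Y).
Proof.
move=> [N [a [b [pa pb ->]]]] [N' [a' [b' [pa' pb' ->]]]].
exists (N + N')%N.
exists (fun i => match split i with inl j => a j | inr j => a' j end).
exists (fun i => match split i with inl j => b j | inr j => b' j end).
split=> [i|i|]; [by case: split | by case: split |].
rewrite big_split_ord /=; congr (_ + _); apply: eq_bigr => i _.
  by case: split_ordP => j /eqP; rewrite ?eq_lshift ?eq_lrshift // => /eqP ->.
by case: split_ordP => j /eqP; rewrite ?eq_rshift ?eq_rlshift // => /eqP ->.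
Qed.

Lemma sepconeZ (m n : nat) (c : C) (X : 'M[C]_(m * n)) :
  0 < c -> sepcone X -> sepcone (c *: X).
Proof.
move=> c0 [N [a [b [pa pb ->]]]]; exists N, (fun i => c *: a i), b.
split=> // [i|]; last first.
  by rewrite scaler_sumr; apply: eq_bigr => i _; rewrite tensmxZl.
have [p t] := pa i; split; first by apply: psdmxZ => //; exact: ltW.
by rewrite mxtraceZ mulr_gt0.
Qed.

Lemma sepcone_scalar (m n : nat) (c : C) :
  (0 < m)%N -> (0 < n)%N -> 0 <= c -> sepcone (c%:M : 'M[C]_(m * n)).
Proof.
(* For [c = 0] the empty sum is used, because a zero factor is excluded from the cone. *)
move=> m0 n0; rewrite le_eqVlt => /orP[/eqP <-|c0].
  by rewrite raddf0; exact: sepcone0.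
rewrite -[c]mulr1 scalar_mx_tens; apply: sepcone_tens.
- by apply: psdmx_scalar; exact: ltW.
- by rewrite mxtrace_scalar pmulrn_lgt0.
- exact: psdmx_scalar.
- by rewrite mxtrace_scalar pmulrn_lgt0.
Qed.

Lemma sepcone_separable (m n : nat) (X : 'M[C]_(m * n)) :
  sepcone X -> state X -> separable X.
Proof.
move=> [N [a [b [pa pb EX]]]] sX; split=> //.
exists N, (fun i => \tr (a i) * \tr (b i)).
exists (fun i => (\tr (a i))^-1 *: a i), (fun i => (\tr (b i))^-1 *: b i).
split=> [i|||i|].
- by have [_ ?] := pa i; have [_ ?] := pb i; rewrite mulr_ge0 ?ltW.
- rewrite -(proj2 sX) EX raddf_sum /=.
  by apply: eq_bigr => i _; rewrite mxtrace_tens.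
- by move=> i; have [] := pa i; exact: state_normalize.
- by have [] := pb i; exact: state_normalize.
rewrite {1}EX; apply: eq_bigr => i _; have [_ ta] := pa i; have [_ tb] := pb i.
rewrite tensmxZl tensmxZr !scalerA -mulrA -invfM mulfV ?scale1r //.
by rewrite mulf_neq0 ?gt_eqF.
Qed.

(** * Hermitian operators shifted into the separable cone *)

Lemma hermsym_shift_psd (n : nat) (A : 'M[C]_n) :
  (0 < n)%N -> A \is hermsymmx ->
  exists2 c : C, 0 <= c &
    (psdmx (c%:M + A) /\ 0 < \tr (c%:M + A)) /\
    (psdmx (c%:M - A) /\ 0 < \tr (c%:M - A)).
Proof.
case: n A => // n A _ hA.
have EA := orthomx_spectralP (hermitian_normalmx hA).
have /mxOverP dR := hermitian_spectral_diag_real hA.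
move: EA (spectral_unitarymx A) (spectral_unit A) dR.
move: (spectralmx A) (spectral_diag A) => P d EA U Pu dR.
(* The sum bounds every eigenvalue in modulus; the extra 1 makes the shifted eigenvalues, hence the
   traces, strictly positive. *)
pose c : C := 1 + \sum_i `|d 0 i|.
have c0 : 0 <= c by rewrite addr_ge0 ?sumr_ge0.
(* The scalar [e] stands for the sign, so that both shifts are treated at once. *)
have shift (e : C) : `|e| = 1 -> e \is Num.real ->
    psdmx (c%:M + e *: A) /\ 0 < \tr (c%:M + e *: A).
  move=> e1 eR; pose f := const_mx c + e *: d.
  have f0 i : 0 < f 0 i.
    rewrite !mxE /c -addrA ltr_wpDr // (bigD1 i) //= -addrA addrCA.
    rewrite addr_ge0 ?sumr_ge0 // -[X in X + _]mul1r -e1 -normrM.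
    have /real_lerNnormlW : e * d 0 i \is Num.real by rewrite realM.
    by move=> /(_ _ (lexx _)); rewrite lerNl -subr_ge0 opprK addrC.
  have E : c%:M + e *: A = invmx P *m diag_mx f *m P.
    rewrite linearD linearZ /= diag_const_mx mulmxDr mulmxDl mul_mx_scalar.
    by rewrite -scalemxAl mulVmx // scalemx1 -scalemxAr -scalemxAl -EA.
  rewrite E; split; first by apply: psdmx_unitary_diag => // i; exact: ltW.
  rewrite mxtrace_mulC mulmxA mulmxV // mul1mx mxtrace_diag.
  by rewrite (bigD1 0) //= ltr_pwDl // sumr_ge0 // => i _; exact: ltW.
exists c => //; split.
  by rewrite -[A]scale1r; apply: shift; rewrite ?normr1.
by rewrite -[A in - A]scale1r -scaleNr; apply: shift; rewrite ?normrN1 ?realN.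
Qed.

(** A lower bound $X \ge -cI$ in the order of the separable cone. Letting [c] depend on [X] makes
    the property stable under sums and positive multiples, so it can be checked term by term. *)
Definition sepdominated (m n : nat) (X : 'M[C]_(m * n)) : Prop :=
  exists2 c : C, 0 <= c & sepcone (c%:M + X).

Lemma sepdominatedD (m n : nat) (X Y : 'M[C]_(m * n)) :
  sepdominated X -> sepdominated Y -> sepdominated (X + Y).
Proof.
move=> [c c0 cX] [e e0 eY]; exists (c + e); first exact: addr_ge0.
by rewrite raddfD /= addrACA; exact: sepconeD.
Qed.

Lemma sepdominatedZ (m n : nat) (e : C) (X : 'M[C]_(m * n)) :
  0 < e -> sepdominated X -> sepdominated (e *: X).
Proof.
move=> e0 [c c0 cX]; exists (e * c); first by rewrite mulr_ge0 // ltW.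
by rewrite -scale_scalar_mx -scalerDr; exact: sepconeZ.
Qed.

Lemma sepdominated_sum (m n : nat) (I : finType) (X : I -> 'M[C]_(m * n)) :
  (forall i, sepdominated (X i)) -> sepdominated (\sum_i X i).
Proof.
move=> dX; apply: big_ind => //; last exact: sepdominatedD.
by exists 0 => //; rewrite raddf0 addr0; exact: sepcone0.
Qed.

Lemma sepdominated_tens (m n : nat) (A : 'M[C]_m) (B : 'M[C]_n) :
  (0 < m)%N -> (0 < n)%N -> A \is hermsymmx -> B \is hermsymmx ->
  sepdominated (tensmx A B).
Proof.
move=> m0 n0 /(hermsym_shift_psd m0) [a a0 [[pA tA] [pA' tA']]].
move=> /(hermsym_shift_psd n0) [b b0 [[pB tB] [pB' tB']]].
exists (a * b); first exact: mulr_ge0.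
have -> : (a * b)%:M = tensmx (a%:M : 'M[C]_m) (b%:M : 'M[C]_n).
  exact: scalar_mx_tens.
(* The mixed terms $aI \otimes B$ and $A \otimes bI$ cancel between the two products. *)
have -> : tensmx a%:M b%:M + tensmx A B = 2^-1 *:
    (tensmx (a%:M + A) (b%:M + B) + tensmx (a%:M - A) (b%:M - B)).
  move: a%:M b%:M => A0 B0; apply/matrixP => i j; rewrite !mxE.
  by field.
apply: sepconeZ; first by rewrite invr_gt0 ltr0n.
by apply: sepconeD; exact: sepcone_tens.
Qed.

(** The real part of $A \otimes B$ is $\mathrm{Re} A \otimes \mathrm{Re} B - \mathrm{Im} A \otimes
    \mathrm{Im} B$, with Hermitian factors. Opposite factors ['i] and [- 'i] absorb the minus sign,
    leaving only positive multiples. *)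
Lemma sepdominated_tens_adj (m n : nat) (A : 'M[C]_m) (B : 'M[C]_n) :
  (0 < m)%N -> (0 < n)%N ->
  sepdominated (tensmx A B + (tensmx A B) ^t*).
Proof.
move=> m0 n0.
have -> : tensmx A B + (tensmx A B) ^t* = 2^-1 *:
    (tensmx (A + A ^t*) (B + B ^t*)
     + tensmx ('i *: A + ('i *: A) ^t*) (- 'i *: B + (- 'i *: B) ^t*)).
  apply/matrixP => x y; rewrite !mxE !rmorphM rmorphN /= conjCi opprK.
  move: (A _ _) (B _ _) (A _ _) (B _ _) => a' b' a b.
  transitivity (2^-1 * ((a + a'^*) * (b + b'^*)
      - 'i ^+ 2 * (a - a'^*) * (b - b'^*))); last by ring.
  by rewrite sqrCi; field.
apply: sepdominatedZ; first by rewrite invr_gt0 ltr0n.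
apply: sepdominatedD; apply: sepdominated_tens => //.
all: by rewrite hermsymmxE adjmxD trmxCK addrC.
Qed.

Lemma sepdominated_hermsym (m n : nat) (X : 'M[C]_(m * n)) :
  (0 < m)%N -> (0 < n)%N -> X \is hermsymmx -> sepdominated X.
Proof.
move=> m0 n0; rewrite hermsymmxE => /eqP hX.
(* Matrix units are not all Hermitian, so each term is paired with its adjoint; the half
   compensates, as [X] is its own adjoint. *)
pose Z x y : 'M[C]_(m * n) := (X x y / 2) *: delta_mx x y.
have -> : X = \sum_x \sum_y (Z x y + (Z x y) ^t*).
  have S : 2^-1 *: X = \sum_x \sum_y Z x y.
    rewrite {1}(matrix_sum_delta X) scaler_sumr; apply: eq_bigr => x _.
    rewrite scaler_sumr; apply: eq_bigr => y _.
    by rewrite scalerA mulrC.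
  have -> : \sum_x \sum_y (Z x y + (Z x y) ^t*)
          = 2^-1 *: X + (2^-1 *: X) ^t*.
    rewrite S linear_sum map_mx_sum -big_split; apply: eq_bigr => x _ /=.
    by rewrite linear_sum map_mx_sum -big_split.
  rewrite adjmxZ -hX -scalerDl fmorphV rmorph_nat.
  have -> : 2^-1 + 2^-1 = 1 :> C by field.
  by rewrite scale1r.
apply: sepdominated_sum => x; apply: sepdominated_sum => y.
case: (mxtens_indexP x) => i j; case: (mxtens_indexP y) => k l.
(* A matrix unit of the product space is $E_{ik} \otimes E_{jl}$; the coefficient, possibly complex,
   goes into the left factor. *)
have -> : Z (mxtens_index (i, j)) (mxtens_index (k, l)) =
    tensmx ((X (mxtens_index (i, j)) (mxtens_index (k, l)) / 2)
              *: delta_mx i k) (delta_mx j l).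
  rewrite tensmxZl; congr (_ *: _); apply/matrixP => u v.
  case: (mxtens_indexP u) => i' j'; case: (mxtens_indexP v) => k' l'.
  rewrite !mxE !mxtens_indexK /= !mxtens_index_eq.
  by rewrite andbACA -mulnb natrM.
exact: sepdominated_tens_adj.
Qed.

(** * Passage to separable states *)

Lemma separable_scaled_difference (m n : nat) (rho1 rho2 : 'M[C]_(m * n)) :
  (0 < m)%N -> (0 < n)%N -> state rho1 -> state rho2 ->
  exists (e : C) (r1 r2 : 'M[C]_(m * n)),
    [/\ 0 < e, separable r1, separable r2 & r1 - r2 = e *: (rho1 - rho2)].
Proof.
move=> m0 n0 [p1 t1] [p2 t2].
have [c1 c1_ge0 K1] := sepdominated_hermsym m0 n0 (proj1 p1).
have [c2 c2_ge0 K2] := sepdominated_hermsym m0 n0 (proj1 p2).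
(* A common shift and the common trace [w] of the shifted states let the multiples of the identity
   cancel in the difference. *)
pose c := c1 + c2; have c_ge0 : 0 <= c by rewrite addr_ge0.
pose w := c *+ (m * n) + 1.
have w_gt0 : 0 < w by rewrite ltr_wpDl // mulrn_wge0.
(* Here [e] is the shift already known to suffice for [rho]; the remaining $e' I$ lies in the cone
   and is added to it. *)
have sep (rho : 'M[C]_(m * n)) (e e' : C) :
    0 <= e' -> e + e' = c -> psdmx rho -> \tr rho = 1 ->
    sepcone (e%:M + rho) -> separable (w^-1 *: (c%:M + rho)).
  move=> e'0 Ec p tr1 K.
  have trw : \tr (c%:M + rho) = w by rewrite mxtraceD mxtrace_scalar tr1.
  have pc : psdmx (c%:M + rho).
    by apply: psdmxD => //; exact: psdmx_scalar.
  apply: sepcone_separable.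
    apply: sepconeZ; first by rewrite invr_gt0.
    rewrite -Ec [e + e']addrC raddfD -addrA /=; apply: sepconeD => //.
    exact: sepcone_scalar.
  by rewrite -trw; apply: state_normalize; rewrite ?trw.
have E : w^-1 *: (c%:M + rho1) - w^-1 *: (c%:M + rho2) = w^-1 *: (rho1 - rho2).
  by rewrite -scalerBr opprD addrACA subrr add0r.
exists w^-1, (w^-1 *: (c%:M + rho1)), (w^-1 *: (c%:M + rho2)); split=> //.
- by rewrite invr_gt0.
- by apply: (sep _ c1 c2).
- by apply: (sep _ c2 c1) => //; rewrite addrC.
Qed.

End Operators.

Theorem lemma1 (R : realType) (d : nat) (hd : (1 <= d)%N)
    (Lambda : R -> {linear 'M[R[i]]_d -> 'M[R[i]]_d})
    (Lambda_cp : forall t, 0 <= t -> completely_positive (Lambda t))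
    (Lambda_tp : forall t, 0 <= t -> trace_preserving (Lambda t))
    (Lambda0 : forall X, Lambda 0 X = X)
    (s t : R) (s_ge0 : 0 <= s) (lt_st : s < t) :
  (exists rho1 rho2 : 'M[R[i]]_(d.+1 * d),
     [/\ state rho1, state rho2 &
         trnorm (id_tensmap (Lambda s) (rho1 - rho2))
         < trnorm (id_tensmap (Lambda t) (rho1 - rho2))]) ->
  exists rho1' rho2' : 'M[R[i]]_(d.+1 * d),
    [/\ separable rho1', separable rho2' &
        trnorm (id_tensmap (Lambda s) (rho1' - rho2'))
        < trnorm (id_tensmap (Lambda t) (rho1' - rho2'))].
Proof.
move=> [rho1 [rho2 [st1 st2 lt_norm]]].
have [e [r1 [r2 [e_gt0 sep1 sep2 E]]]] :=
  separable_scaled_difference (ltn0Sn d) hd st1 st2.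
exists r1, r2; split; [exact: sep1 | exact: sep2 |].
have e_ge0 := ltW e_gt0.
(* The positive factor [e] leaves both trace norms and cancels from the strict inequality. *)
rewrite E (trnorm_id_tensmapZ (Lambda s) _ e_ge0).
rewrite (trnorm_id_tensmapZ (Lambda t) _ e_ge0) (ltr_pM2l e_gt0).
exact: lt_norm.
Qed.
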